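(* Let $n\in\mathbb{N}$, let $c=(c_{i,j})$ be an $n\times(n+1)$ matrix with entries in $\{0,1\}$, $\sigma_1,\ldots,\sigma_n>0$, $\gamma_1,\ldots,\gamma_{n+1}>0$, with $\sum_jc_{i,j}\gamma_j>0$ for each $i$. Let $\boldsymbol{\Lambda}=(\Lambda_1,\ldots,\Lambda_n)'$ have independent coordinates $\Lambda_i\sim Exp(1)$. Let $Y_1,\ldots,Y_{n+1}$ be mutually independent with $Y_j\sim Ga(\gamma_j,1)$, and let $\boldsymbol{\Xi}=(\Xi_1,\ldots,\Xi_n)'$ with $\Xi_i=\sum_{j=1}^{n+1}\frac{c_{i,j}}{\sigma_i}Y_j$; assume $\boldsymbol{\Lambda}$ and $\boldsymbol{\Xi}$ are independent. Then a random vector $\mathbf{X}=(X_1,\ldots,X_n)'$ has decumulative distribution function \[ \mathbf{P}[X_1>x_1,\ldots,X_n>x_n]=\prod_{j=1}^{n+1}\left(1+\sum_{i=1}^n\frac{c_{i,j}}{\sigma_i}x_i\right)^{-\gamma_j},\quad (x_1,\ldots,x_n)'\in(0,\infty)^n, \] if and only if $(X_1,\ldots,X_n)'$ is equal in distribution to $(\Lambda_1/\Xi_1,\ldots,\Lambda_n/\Xi_n)'$.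
   Context: $Exp(\lambda)$ is the exponential distribution with rate $\lambda$; $Ga(\gamma,1)$ is the gamma distribution with shape $\gamma$ and rate $1$. *)

(* Defs.v *)
From HB Require Import structures.
From mathcomp Require Import all_boot all_order all_algebra.
From mathcomp Require Import all_classical all_reals all_analysis.
From mathcomp Require Import exponential_distribution.
Set Implicit Arguments. Unset Strict Implicit. Unset Printing Implicit Defensive.
Import Order.TTheory GRing.Theory Num.Theory.
Local Open Scope classical_set_scope.
Local Open Scope ring_scope.

Definition rectangles (R : realType) (n : nat) : set (set ('I_n -> R)) :=
  [set B | exists A : 'I_n -> set R, (forall i, measurable (A i)) /\
           B = \bigcap_(i in [set: 'I_n]) ((fun x => x i) @^-1` (A i))].

Definition Rn_measurable (R : realType) (n : nat) (B : set ('I_n -> R)) :=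
  <<s @rectangles R n >> B.

Definition eq_in_distribution (R : realType) (n : nat)
  (d1 d2 : measure_display) (T1 : measurableType d1) (T2 : measurableType d2)
  (P1 : probability T1 R) (P2 : probability T2 R)
  (X1 : 'I_n -> T1 -> R) (X2 : 'I_n -> T2 -> R) : Prop :=
  forall B, Rn_measurable B ->
    P1 ((fun t => fun i => X1 i t) @^-1` B) =
    P2 ((fun t => fun i => X2 i t) @^-1` B).

Definition mutually_independent (R : realType) (d : measure_display)
  (T : measurableType d) (P : probability T R) (I : finType)
  (X : I -> T -> R) : Prop :=
  forall A : I -> set R, (forall i, measurable (A i)) ->
    P (\bigcap_(i in [set: I]) (X i @^-1` A i)) =
    (\prod_(i : I) P (X i @^-1` A i))%E.

Definition independent_vectors (R : realType) (d : measure_display)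
  (T : measurableType d) (P : probability T R) (n m : nat)
  (U : 'I_n -> T -> R) (V : 'I_m -> T -> R) : Prop :=
  forall (A : set ('I_n -> R)) (B : set ('I_m -> R)),
    Rn_measurable A -> Rn_measurable B ->
    P (((fun t => fun i => U i t) @^-1` A) `&` ((fun t => fun i => V i t) @^-1` B)) =
    (P ((fun t => fun i => U i t) @^-1` A) * P ((fun t => fun i => V i t) @^-1` B))%E.

Definition Gamma_fun (R : realType) (g : R) : R :=
  fine (\int[lebesgue_measure]_(y in (`]0%R, +oo[%classic : set R))
          ((y `^ (g - 1)) * expR (- y))%:E)%E.

Definition gamma_prob (R : realType) (g : R) (A : set R) : \bar R :=
  (\int[lebesgue_measure]_(y in A `&` (`]0%R, +oo[%classic : set R))
     ((y `^ (g - 1)) * expR (- y) / Gamma_fun g)%:E)%E.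

Definition has_exp_law (R : realType) (d : measure_display) (T : measurableType d)
  (P : probability T R) (rate : R) (X : T -> R) : Prop :=
  forall A, measurable A -> P (X @^-1` A) = exponential_prob rate A.

Definition has_gamma_law (R : realType) (d : measure_display) (T : measurableType d)
  (P : probability T R) (g : R) (X : T -> R) : Prop :=
  forall A, measurable A -> P (X @^-1` A) = gamma_prob g A.

(* Main.v *)
(** If [L] has independent [Exp(1)] coordinates and is independent of the a.s.
positive vector [V], then conditioning on [V] gives
[P(L_i / V_i > x_i for all i) = E exp(- sum_i x_i V_i)].  For
[V_i = sum_j w_ij Y_j] the exponent is [sum_j s_j Y_j] with
[s_j = sum_i w_ij x_i], so the right-hand side is the product of the gamma
Laplace transforms [(1 + s_j)^(- gam_j)].  Conversely, the tails at positive
points determine the law: the reference vector is a.s. positive, so letting the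
thresholds decrease to [0] shows that [X] is a.s. positive too; hence the two
vectors have the same tails everywhere, and the open upper boxes form a
pi-system generating the sigma-algebra of [R^n]. *)

Require Import Defs.
From HB Require Import structures.
From mathcomp Require Import all_boot all_order all_algebra.
From mathcomp Require Import all_classical all_reals all_analysis.
From mathcomp Require Import exponential_distribution measurable_realfun.
Import Order.TTheory GRing.Theory Num.Theory.
Import numFieldNormedType.Exports HBNNSimple.
Local Open Scope classical_set_scope.
Local Open Scope ring_scope.

(** * Integrals against image measures with a density *)

(** By monotone convergence along simple functions, [m], [U] and [G] enter only through the
    [G]-weighted masses of preimages under [U], so two such integrals can be compared term by
    term. *)
Lemma integral_weighted_lim {R : realType} {d d' : measure_display}
  {T : measurableType d} {S : measurableType d'} (m : {measure set T -> \bar R})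
  (U : T -> S) (G : T -> R) (f : {nnsfun S >-> R}^nat) (g : S -> \bar R) :
  measurable_fun setT U -> measurable_fun setT G -> (forall t, 0 <= G t) ->
  nondecreasing_seq (f : (S -> R)^nat) ->
  (forall x, EFin \o f^~ x @ \oo --> g x) ->
  (\int[m]_t (g (U t) * (G t)%:E) =
   limn (fun n => \sum_(k \in range (f n))
     (k%:E * \int[m]_(t in U @^-1` (f n @^-1` [set k])) (G t)%:E)))%E.
Proof.
move=> mU mG G0 ndf fg.
have mEG : measurable_fun setT (EFin \o G) by exact/measurable_EFinP.
have mpre n k : measurable (U @^-1` (f n @^-1` [set k])).
  by rewrite -[X in measurable X]setTI; apply: mU.
have mfU n : measurable_fun setT (fun t => (f n (U t))%:E).
  by apply/measurable_EFinP; apply: measurableT_comp.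
transitivity (\int[m]_t (limn (fun n => (f n (U t))%:E * (G t)%:E)))%E.
  apply: eq_integral => t _; apply/esym/cvg_lim => //.
  apply: cvgeZr => //; exact: fg.
rewrite monotone_convergence//; last 3 first.
- by move=> n; apply: emeasurable_funM.
- by move=> n t _; rewrite mule_ge0// lee_fin.
- move=> t _ n1 n2 n12; apply: lee_wpmul2r => //.
    by rewrite lee_fin.
  by rewrite lee_fin; exact/lefP/ndf.
congr (limn _); apply/funext => n.
transitivity (\int[m]_t (\sum_(k \in range (f n))
    ((k * \1_(f n @^-1` [set k]) (U t))%:E * (G t)%:E)))%E.
  apply: eq_integral => t _; rewrite {1}(fimfunE (f n)) -fsumEFin//.
  rewrite ge0_mule_fsuml// => k; exact: nnfun_muleindic_ge0.
rewrite ge0_integral_fsum//; last 2 first.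
- move=> k; apply: emeasurable_funM => //; apply/measurable_EFinP.
  apply: measurable_funM => //; apply: measurableT_comp => //.
- by move=> k t _; rewrite mule_ge0//; [exact: nnfun_muleindic_ge0|rewrite lee_fin].
(* Membership in the range of [f n] makes the coefficient nonnegative, as needed to take it out of
   the integral. *)
apply: eq_fsbigr => k /set_mem [x _ <-].
rewrite [in RHS]integral_mkcond -ge0_integralZl//.
- apply: eq_integral => t _; rewrite patchE/= indicE.
  rewrite [in LHS]EFinM -muleA; congr (_ * _)%E.
  case: ifPn => [/set_mem tk|/negP tk]; first by rewrite mem_set// mul1e.
  by rewrite memNset ?mul0e// => ?; apply: tk; exact: mem_set.
- by apply/measurable_restrict; rewrite ?setTI//; exact: measurable_funTS.
- by move=> t _; rewrite patchE; case: ifP; rewrite ?lee_fin.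
- by rewrite lee_fin.
Qed.

(** The hypothesis says that the measures with densities [G1] and [G2] have the same image under
    [U1] and [U2]. This serves below as a change of variables, as the passage from a law to its
    density, and to decouple independent factors. *)
Lemma eq_integral_weighted {R : realType} {d1 d2 d' : measure_display}
  {T1 : measurableType d1} {T2 : measurableType d2} {S : measurableType d'}
  (m1 : {measure set T1 -> \bar R}) (m2 : {measure set T2 -> \bar R})
  (U1 : T1 -> S) (U2 : T2 -> S) (G1 : T1 -> R) (G2 : T2 -> R)
  (g : S -> \bar R) :
  measurable_fun setT U1 -> measurable_fun setT G1 -> (forall t, 0 <= G1 t) ->
  measurable_fun setT U2 -> measurable_fun setT G2 -> (forall t, 0 <= G2 t) ->
  (forall A, measurable A ->
    \int[m1]_(t in U1 @^-1` A) (G1 t)%:E =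
    \int[m2]_(t in U2 @^-1` A) (G2 t)%:E)%E ->
  measurable_fun setT g -> (forall x, 0 <= g x)%E ->
  (\int[m1]_t (g (U1 t) * (G1 t)%:E) = \int[m2]_t (g (U2 t) * (G2 t)%:E))%E.
Proof.
move=> mU1 mG1 G10 mU2 mG2 G20 eqG mg g0.
pose f := nnsfun_approx measurableT mg.
have ndf : nondecreasing_seq (f : (S -> R)^nat) by exact: nd_nnsfun_approx.
have fg x : EFin \o f^~ x @ \oo --> g x.
  by apply: cvg_nnsfun_approx => //= *; exact: g0.
rewrite (integral_weighted_lim m1 _ _ _ _ mU1 mG1 G10 ndf fg).
rewrite (integral_weighted_lim m2 _ _ _ _ mU2 mG2 G20 ndf fg).
congr (limn _); apply/funext => n; apply: eq_fsbigr => k _.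
by rewrite eqG//; exact: measurable_funPTI.
Qed.

(** * Product rule for expectations of independent variables *)

Lemma prod_indic {R : realType} {T S : Type} (I : finType) (Y : I -> T -> S)
    (A : I -> set S) (t : T) :
  \prod_i \1_(A i) (Y i t) = \1_(\bigcap_(i in [set: I]) (Y i @^-1` A i)) t :> R.
Proof.
rewrite [RHS]indicE; case: (boolP (t \in _)) => [/set_mem At|/negP At].
  by rewrite big1// => i _; rewrite indicE mem_set//; exact: At.
have [i Ai] : exists i, ~ A i (Y i t).
  by apply/existsNP => Ai; apply: At; apply: mem_set => i _; exact: Ai.
by rewrite (bigD1 i)//= indicE memNset// mul0r.
Qed.

Lemma expectation_prod_indep {R : realType} {d : measure_display}
  {T : measurableType d} (P : probability T R) (I : finType)
  (Y : I -> T -> R) (h : I -> R -> R) :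
  mutually_independent P Y -> (forall i, measurable_fun setT (Y i)) ->
  (forall i, measurable_fun setT (h i)) -> (forall i x, 0 <= h i x) ->
  (forall i, \int[P]_t (h i (Y i t))%:E \is a fin_num)%E ->
  (\int[P]_t (\prod_i h i (Y i t))%:E = \prod_i \int[P]_t (h i (Y i t))%:E)%E.
Proof.
move=> indY mY.
(* Induction on the indices [s] at which [h i] need not be an indicator: the
   base case is the definition of independence. *)
suff H (s : seq I) : forall h : I -> R -> R,
    (forall i, i \notin s -> exists2 A, measurable A & h i = \1_A) ->
    (forall i, measurable_fun setT (h i)) -> (forall i x, 0 <= h i x) ->
    (forall i, \int[P]_t (h i (Y i t))%:E \is a fin_num)%E ->
  (\int[P]_t (\prod_i h i (Y i t))%:E = \prod_i \int[P]_t (h i (Y i t))%:E)%E.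
  by apply: (H (enum I)) => i; rewrite mem_enum.
have mYA i A : measurable A -> measurable (Y i @^-1` A).
  by move=> mA; rewrite -[X in measurable X]setTI; exact: mY.
have indicY i A : measurable A ->
    (\int[P]_t (\1_A (Y i t))%:E = P (Y i @^-1` A))%E.
  by move=> mA; rewrite -[X in _ = P X]setIT -integral_indic//; exact: mYA.
elim: s => [|k s IH] {}h hs mh h0 hfin.
  have /choice[A hA] i : exists A, measurable A /\ h i = \1_A.
    by have [//|A ? ?] := hs i; exists A.
  transitivity (P (\bigcap_(i in [set: I]) (Y i @^-1` A i))).
    rewrite -[X in _ = P X]setIT -integral_indic//; last first.
      by apply: fin_bigcap_measurable => // i _; apply: mYA; have [] := hA i.
    apply: eq_integral => t _; rewrite -prod_indic; congr (_%:E).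
    by apply: eq_bigr => i _; have [_ ->] := hA i.
  rewrite indY; last by move=> i; have [] := hA i.
  by apply: eq_bigr => i _; have [mA ->] := hA i; rewrite indicY.
pose G t := \prod_(i | i != k) h i (Y i t).
(* Weights are real valued, hence [fine]; nothing is lost because the expectations are finite. *)
pose C := \prod_(i | i != k) fine (\int[P]_t (h i (Y i t))%:E).
have CE : (C%:E = \prod_(i | i != k) \int[P]_t (h i (Y i t))%:E)%E.
  by rewrite -prodEFin; apply: eq_bigr => i _; rewrite fineK.
have mG : measurable_fun setT G.
  rewrite /G; under eq_fun do rewrite -big_filter.
  by apply: measurable_prod => i _; exact: measurableT_comp.
have G0 t : 0 <= G t by exact: prodr_ge0.
have C0 : 0 <= C.
  by apply: prodr_ge0 => i _; rewrite fine_ge0// integral_ge0// => *; rewrite lee_fin.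
transitivity (\int[P]_t ((h k (Y k t))%:E * (G t)%:E))%E.
  by apply: eq_integral => t _; rewrite -EFinM (bigD1 k).
rewrite (bigD1 k)//= -CE.
(* Only the weight changes, from the random [G] to the constant [C]. On an event [Y k] in [A] the
   two weighted masses agree by the induction hypothesis, with [h k] replaced by [\1_A]. *)
rewrite (eq_integral_weighted P P _ (Y k) G (cst C) (EFin \o h k))//=.
- rewrite ge0_integralZr//.
  + by apply/measurable_EFinP; exact: measurableT_comp.
  + by move=> *; rewrite lee_fin.
- move=> A mA.
  rewrite integral_cst; last exact: mYA.
  pose h' i := if i == k then \1_A else h i.
  have h'k : h' k = \1_A by rewrite /h' eqxx.
  transitivity (\int[P]_t (\prod_i h' i (Y i t))%:E)%E.
    rewrite integral_mkcond; apply: eq_integral => t _.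
    rewrite (bigD1 k)//= h'k patchE indicE.
    rewrite (eq_bigr (fun i => h i (Y i t))) => [|i /negbTE ik]; last first.
      by rewrite /h' ik.
    case: ifPn => [/set_mem tk|/negP tk]; first by rewrite mem_set// mul1r.
    by rewrite memNset ?mul0r// => ?; apply: tk; exact: mem_set.
  rewrite IH.
  + rewrite (bigD1 k)//= h'k indicY// muleC CE; congr (_ * _)%E.
    by apply: eq_bigr => i ik; rewrite /h' (negbTE ik).
  + move=> i; rewrite /h'; case: eqVneq => [_ _|ik iNs]; first by exists A.
    by apply: hs; rewrite inE negb_or ik.
  + by move=> i; rewrite /h'; case: ifP.
  + by move=> i x; rewrite /h'; case: ifP.
  + move=> i; rewrite /h'; case: ifP => // _; rewrite indicY//.
    by rewrite fin_num_measure//; exact: mYA.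
- exact/measurable_EFinP.
- by move=> x; rewrite lee_fin.
Qed.

(** * Dilations and the Laplace transform of the gamma law *)

(** Lebesgue measure is determined by its values on the intervals []b, c]], so the pushforward under
    multiplication by [a], scaled by [a], need only be evaluated there. *)
Lemma lebesgue_measure_dilation {R : realType} (a : R) (A : set R) :
  0 < a -> measurable A ->
  (a%:E * lebesgue_measure ((fun x => a * x)%R @^-1` A) = lebesgue_measure A)%E.
Proof.
move=> a0 mA.
have mM : measurable_fun [set: measurableTypeR R] 
    (fun x : R => a * x : measurableTypeR R).
  exact: measurable_funM.
pose nu : {measure set (measurableTypeR R) -> \bar R} :=
  mscale (NngNum (ltW a0))
    (measure_function_pushforward__canonical__measure_function_Measure
      (@lebesgue_measure R) mM).
transitivity (nu A) => //.
apply/esym/lebesgue_measure_unique => // _ [[b c] _ <-].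
rewrite /nu/= /mscale/= /pushforward.
have -> : (fun x => a * x) @^-1` `]b, c]%classic = `]b / a, c / a]%classic.
  apply/seteqP; split=> x /=; rewrite !in_itv/= ltr_pdivrMr// ler_pdivlMr//;
  by rewrite mulrC.
rewrite !lebesgue_measure_itv/= !lte_fin ltr_pM2r ?invr_gt0//.
case: ifP => _; last by rewrite mule0.
by rewrite -!EFinB -EFinM mulrBr !mulrA ![a * _]mulrC !mulfK ?gt_eqF.
Qed.

Lemma ge0_integral_dilation {R : realType} (a : R) (f : R -> \bar R) :
  0 < a -> measurable_fun setT f -> (forall x, 0 <= f x)%E ->
  (\int[lebesgue_measure]_x f x = a%:E * \int[lebesgue_measure]_x f (a * x)%R)%E.
Proof.
move=> a0 mf f0.
have ma : measurable_fun [set: R] ( *%R a) by exact: measurable_funM.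
(* The factor [a] becomes a constant weight, so that both sides are weighted integrals of [f]. *)
rewrite muleC -ge0_integralZr//; last 2 first.
- exact: measurableT_comp.
- by rewrite lee_fin ltW.
rewrite (eq_integral_weighted _ lebesgue_measure _ idfun _ (cst 1) f)//=.
- by apply: eq_integral => x _; rewrite mule1.
- by move=> _; exact: ltW.
- exact: measurable_id.
- move=> A mA; rewrite !integral_cst ?mul1e//.
    exact: lebesgue_measure_dilation.
  by rewrite -[X in measurable X]setTI; exact: ma.
Qed.

(** Extended by 0 to the whole line, so that dilations do not change the domain of integration. *)
Definition gamma_pdf {R : realType} (g y : R) : R :=
  if 0 < y then y `^ (g - 1) * expR (- y) / Gamma_fun g else 0.

Lemma gamma_pdf_ge0 {R : realType} (g y : R) : 0 <= gamma_pdf g y.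
Proof.
rewrite /gamma_pdf; case: ifP => // _.
rewrite divr_ge0 ?mulr_ge0 ?powR_ge0 ?expR_ge0//.
rewrite fine_ge0// integral_ge0// => z _.
by rewrite lee_fin mulr_ge0 ?powR_ge0 ?expR_ge0.
Qed.

Lemma measurable_gamma_pdf {R : realType} (g : R) :
  measurable_fun setT (gamma_pdf g).
Proof.
apply: measurable_fun_if => //; first exact: measurable_fun_ltr.
apply: measurable_funTS.
apply: measurable_funM => //; apply: measurable_funM => //.
exact: measurableT_comp.
Qed.

Lemma gamma_probE {R : realType} (g : R) (A : set R) :
  (gamma_prob g A = \int[lebesgue_measure]_(y in A) (gamma_pdf g y)%:E)%E.
Proof.
rewrite /gamma_prob integral_mkcondr; apply: eq_integral => y _.
by rewrite /gamma_pdf patchE mem_setE in_itv/= andbT; case: ifP.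
Qed.

(** Tilting by an exponential is a dilation up to a constant: the exponents add up to $-(1+t)y$, and
    the power of $y$ is homogeneous. *)
Lemma expR_gamma_pdf {R : realType} (g t y : R) : 0 <= t ->
  expR (- (t * y)) * gamma_pdf g y =
  (1 + t) `^ (1 - g) * gamma_pdf g ((1 + t) * y).
Proof.
move=> t0; have a0 : 0 < 1 + t by rewrite ltr_wpDr.
rewrite /gamma_pdf pmulr_rgt0//.
case: ifPn => y0; last by rewrite !mulr0.
rewrite powRM ?ltW// -(opprB g) powRN !mulrA; congr (_ / _).
rewrite mulVf ?mul1r ?gt_eqF ?powR_gt0// mulrAC -expRD mulrC; congr (_ * expR _).
by rewrite mulrDl mul1r opprD addrC.
Qed.

(** The tilted density is $(1+t)^{1-g}$ times a dilated copy of the density, and this copy has mass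
    $(1+t)^{-1}$. *)
Lemma gamma_Laplace {R : realType} {d : measure_display}
  {T : measurableType d} (P : probability T R) (g t : R) (Y : T -> R) :
  measurable_fun setT Y -> has_gamma_law P g Y -> 0 <= t ->
  (\int[P]_w (expR (- (t * Y w)))%:E = ((1 + t) `^ (- g))%:E)%E.
Proof.
move=> mY lawY t0; have a0 : 0 < 1 + t by rewrite ltr_wpDr.
have mg := measurable_gamma_pdf g; have g0 := gamma_pdf_ge0 g.
transitivity (\int[P]_w ((expR (- (t * Y w)))%:E * (cst 1 w)%:E))%E.
  by apply: eq_integral => w _; rewrite mule1.
rewrite (eq_integral_weighted P lebesgue_measure Y idfun _ (gamma_pdf g)
  (fun y => (expR (- (t * y)))%:E))//; last 3 first.
- exact: measurable_id.
- move=> A mA; rewrite -gamma_probE -lawY//= integral_cst ?mul1e//.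
  by rewrite -[X in measurable X]setTI; exact: mY.
- apply/measurable_EFinP; apply: measurableT_comp => //.
  by apply: measurableT_comp => //; exact: measurable_funM.
(* The law has mass 1, so the gamma integral need not be evaluated. *)
have q1 : (\int[lebesgue_measure]_y (gamma_pdf g y)%:E = 1)%E.
  by rewrite -gamma_probE -lawY// preimage_setT probability_setT.
under eq_integral do rewrite -EFinM expR_gamma_pdf// EFinM.
have mga : measurable_fun setT (fun y => (gamma_pdf g ((1 + t) * y))%:E).
  by apply/measurable_EFinP; apply: measurableT_comp => //; exact: measurable_funM.
rewrite ge0_integralZl//=; last 2 first.
- by move=> *; rewrite lee_fin.
- by rewrite lee_fin powR_ge0.
have q1' : (\int[lebesgue_measure]_y (gamma_pdf g ((1 + t) * y)%R)%:E = ((1 + t)^-1)%:E)%E.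
  have := q1; rewrite (ge0_integral_dilation _ _ a0); last 2 first.
  - exact/measurable_EFinP.
  - by move=> *; rewrite lee_fin.
  move=> /(congr1 (fun z => ((1 + t)^-1)%:E * z)%E).
  by rewrite muleA -EFinM mulVf ?mul1e ?mule1// gt_eqF.
rewrite q1' -EFinM -powR_inv1 ?ltW// -powRD; last first.
  by apply/implyP => _; rewrite gt_eqF.
by rewrite addrAC subrr add0r.
Qed.

(** * Exponential tails and almost sure positivity *)

Lemma exp_law_tail {R : realType} {d : measure_display}
  {T : measurableType d} (P : probability T R) (L : T -> R) (a : R) :
  measurable_fun setT L -> has_exp_law P 1 L -> 0 <= a ->
  P (L @^-1` `]a, +oo[) = (expR (- a))%:E.
Proof.
move=> mL lawL a0.
have mpre (A : set R) : measurable A -> measurable (L @^-1` A).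
  by move=> mA; rewrite -[X in measurable X]setTI; exact: mL.
have -> : L @^-1` `]a, +oo[ = ~` (L @^-1` `]-oo, a]).
  by rewrite -setCitvl.
rewrite probability_setC; last by apply: mpre; exact: measurable_itv.
rewrite lawL//.
(* The density vanishes on the negative half-line, which leaves an interval with a closed
   formula. *)
have -> : exponential_prob 1 `]-oo, a] = exponential_prob 1 `[0, a].
  rewrite /exponential_prob integral_mkcond [RHS]integral_mkcond.
  apply: eq_integral => x _; rewrite !patchE !mem_setE !in_itv/=.
  by have [x0|//] := ltP x 0; rewrite lt0_exponential_pdf// if_same.
(* The closed formula is for [0 < a]; at 0 the interval is a null singleton. *)
move: a0; rewrite le_eqVlt => /predU1P[<-|a0].
  by rewrite set_itv1 /exponential_prob integral_set1 sube0 oppr0 expR0.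
rewrite exponential_prob_itv0c// mulN1r.
by rewrite oppeB// addeA subee// add0e.
Qed.

Lemma ae_probability1 {R : realType} {d : measure_display}
  {T : measurableType d} (P : probability T R) (A : set T) :
  measurable A -> P A = 1%E -> {ae P, forall t, A t}.
Proof.
move=> mA PA; exists (~` A); split => //; first exact: measurableC.
by rewrite probability_setC// PA subee.
Qed.

(** [gamma_prob] integrates over the open half-line only, so it gives that half-line the same mass
    as the whole line, which is 1 because it is the law of [Y]. *)
Lemma gamma_law_gt0 {R : realType} {d : measure_display}
  {T : measurableType d} (P : probability T R) (g : R) (Y : T -> R) :
  measurable_fun setT Y -> has_gamma_law P g Y -> {ae P, forall t, 0 < Y t}.
Proof.
move=> mY lawY.
have PY : P (Y @^-1` `]0, +oo[) = 1%E.
  rewrite lawY// -(@probability_setT _ _ _ P) -(preimage_setT Y) lawY//.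
  by rewrite /gamma_prob setTI setIid.
apply: filterS (ae_probability1 _ _ _ PY) => [t/=|].
  by rewrite in_itv/= andbT.
by rewrite -[X in measurable X]setTI; exact: mY.
Qed.

Lemma exp_law_gt0 {R : realType} {d : measure_display}
  {T : measurableType d} (P : probability T R) (L : T -> R) :
  measurable_fun setT L -> has_exp_law P 1 L -> {ae P, forall t, 0 < L t}.
Proof.
move=> mL lawL.
have := exp_law_tail _ _ _ mL lawL (lexx 0); rewrite oppr0 expR0 => PL.
apply: filterS (ae_probability1 _ _ _ PL) => [t/=|].
  by rewrite in_itv/= andbT.
by rewrite -[X in measurable X]setTI; exact: mL.
Qed.

(** * Random vectors and conditioning on an independent vector *)

Lemma measurable_vector {R : realType} {n : nat} {d : measure_display}
  {T : measurableType d} (U : 'I_n -> T -> R) :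
  (forall i, measurable_fun setT (U i)) ->
  measurable_fun setT
    ((fun t => U^~ t) : T -> g_sigma_algebraType (@rectangles R n)).
Proof.
move=> mU.
pose G : set (set (g_sigma_algebraType (@rectangles R n))) := @rectangles R n.
apply: (measurability G) => // _ [_ [A [mA ->]] <-].
rewrite setTI preimage_bigcap; apply: fin_bigcap_measurable => // i _.
by rewrite -[X in measurable X]setTI; exact: mU.
Qed.

Lemma measurable_coordinate {R : realType} {n : nat} (i : 'I_n) :
  measurable_fun setT
    ((fun x => x i) : g_sigma_algebraType (@rectangles R n) -> R).
Proof.
move=> _ A mA; rewrite setTI; apply: sub_gen_smallest.
exists (fun j => if j == i then A else setT); split; first by move=> j; case: ifP.
apply/seteqP; split => x /=; first by move=> xA j _ /=; case: eqVneq => // ->.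
by move=> /(_ i Logic.I)/=; rewrite eqxx.
Qed.

(** Independence is the product rule on measurable rectangles, so the joint law is the product of
    the two laws, and Tonelli integrates over the value of [V]. *)
Lemma independent_vectors_fubini {R : realType} {n m : nat}
  {d : measure_display} {T : measurableType d} (P : probability T R)
  (U : 'I_n -> T -> R) (V : 'I_m -> T -> R)
  (D : set (g_sigma_algebraType (@rectangles R n) *
            g_sigma_algebraType (@rectangles R m))) :
  (forall i, measurable_fun setT (U i)) ->
  (forall i, measurable_fun setT (V i)) ->
  independent_vectors P U V -> measurable D ->
  measurable_fun setT (fun t => P [set s | D (U^~ s, V^~ t)]) /\
  (P [set t | D (U^~ t, V^~ t)] =
   \int[P]_t P [set s | D (U^~ s, V^~ t)])%E.
Proof.
move=> mU mV indUV mD.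
have mu := measurable_vector U mU.
have mv := measurable_vector V mV.
pose u : {mfun T >-> g_sigma_algebraType (@rectangles R n)} :=
  mfun_Sub (mem_set mu).
pose v : {mfun T >-> g_sigma_algebraType (@rectangles R m)} :=
  mfun_Sub (mem_set mv).
have muv := measurable_fun_pair mu mv.
pose uv : {mfun T >-> (g_sigma_algebraType (@rectangles R n) *
            g_sigma_algebraType (@rectangles R m))%type} :=
  mfun_Sub (mem_set muv).
have E1 : ((distribution P u \x distribution P v) D = distribution P uv D)%E.
  by apply: product_measure_unique.
(* [\x] integrates sections at a fixed first coordinate, [\x^] at a fixed second one; the latter
   fits, since the value of [V] is to be frozen. *)
have E2 : ((distribution P u \x distribution P v) D =
    (distribution P u \x^ distribution P v) D)%E.
  by apply: product_measure_unique => // A B mA mB; exact: product_measure2E.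
have sectionE t : P [set s | D (U^~ s, V^~ t)] =
    (distribution P u \o ysection D) (v t).
  by congr (P _); apply/seteqP; split => s /=; rewrite ysectionE.
have msection : measurable_fun setT (distribution P u \o ysection D).
  exact: measurable_fun_ysection.
under eq_fun do rewrite sectionE; split; first exact: measurableT_comp.
transitivity (distribution P uv D) => //.
by rewrite -E1 E2 /product_measure2 ge0_integral_pushforward.
Qed.

Lemma probability_eq_ae {R : realType} {d : measure_display}
  {T : measurableType d} (P : probability T R) (A B : set T) :
  measurable A -> measurable B -> {ae P, forall t, A t <-> B t} -> P A = P B.
Proof.
move=> mA mB AB.
rewrite -[A]setIT -[B]setIT -!integral_indic//.
apply: ge0_ae_eq_integral => //.
- exact/measurable_EFinP.
- exact/measurable_EFinP.
- apply: filterS AB => t AB _; rewrite !indicE; congr (_%:R%:E).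
  by congr nat_of_bool; apply/idP/idP => /set_mem /AB ?; exact: mem_set.
Qed.

(** * Tails of the ratios *)

Lemma upper_tailE {R : realType} {n : nat} {T : Type} (X : 'I_n -> T -> R)
  (a : 'I_n -> R) :
  \bigcap_(i in [set: 'I_n]) (X i @^-1` `]a i, +oo[) =
  [set t | forall i, a i < X i t].
Proof.
apply/seteqP; split => t /= h i; last by rewrite /= in_itv/= andbT.
by have := h i Logic.I; rewrite /= in_itv/= andbT.
Qed.

Lemma exp_ratio_tail {R : realType} {n : nat} {d : measure_display}
  {T : measurableType d} (P : probability T R) (L V : 'I_n -> T -> R)
  (x : 'I_n -> R) :
  (forall i, measurable_fun setT (L i)) -> (forall i, has_exp_law P 1 (L i)) ->
  mutually_independent P L -> (forall i, measurable_fun setT (V i)) ->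
  (forall i, {ae P, forall t, 0 < V i t}) -> independent_vectors P L V ->
  (forall i, measurable_fun setT (fun t => L i t / V i t)) ->
  (forall i, 0 < x i) ->
  (P (\bigcap_(i in [set: 'I_n]) ((fun t => L i t / V i t)%R @^-1` `]x i, +oo[)) =
   \int[P]_t (expR (- (\sum_i x i * V i t)))%:E)%E.
Proof.
move=> mL lawL indL mV V0 indLV mLV x0.
have {}V0 : {ae P, forall t i, 0 < V i t} by exact: filter_forall.
(* The ratio event with denominators cleared; it agrees with the original one wherever all [V i] are
   positive, hence almost surely. *)
pose D := [set p : g_sigma_algebraType (@rectangles R n) *
                   g_sigma_algebraType (@rectangles R n) |
           forall i, x i * p.2 i < p.1 i].
have mD : measurable D.
  have -> : D = \bigcap_(i in [set: 'I_n]) [set p | x i * p.2 i < p.1 i].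
    by apply/seteqP; split => p /= Dp i; [move=> _|]; exact: Dp.
  apply: fin_bigcap_measurable => // i _.
  rewrite -[X in measurable X]setTI; apply: measurable_fun_ltr => //.
    apply: measurable_funM => //.
    exact: (measurableT_comp (measurable_coordinate i)).
  exact: (measurableT_comp (measurable_coordinate i)).
have [msec PD] := independent_vectors_fubini P L V D mL mV indLV mD.
transitivity (P [set t | D (L^~ t, V^~ t)]).
  apply: probability_eq_ae.
  - apply: fin_bigcap_measurable => // i _.
    by rewrite -[X in measurable X]setTI; exact: mLV.
  - rewrite -[X in measurable X]setTI.
    exact: (measurable_fun_pair (measurable_vector L mL) (measurable_vector V mV)).
  rewrite upper_tailE; apply: filterS V0 => t V0.
  by split => /= h i; have := h i; rewrite ltr_pdivlMr.
rewrite PD; apply: ge0_ae_eq_integral => //.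
- apply/measurable_EFinP; apply: measurableT_comp => //.
  apply: measurableT_comp => //; apply: measurable_sum => i.
  exact: measurable_funM.
(* With [V] frozen, the section is an upper box with corner [x i * V i t], which is nonnegative, so
   the exponential tail formula holds in each coordinate. *)
- apply: filterS V0 => t V0 _.
  transitivity (P (\bigcap_(i in [set: 'I_n]) (L i @^-1` `]x i * V i t, +oo[))).
    by rewrite upper_tailE.
  rewrite indL//.
  under eq_bigr do rewrite exp_law_tail ?mulr_ge0// ?ltW//.
  by rewrite prodEFin -sumrN expR_sum.
Qed.

Lemma gamma_sum_Laplace {R : realType} {n m : nat} {d : measure_display}
  {T : measurableType d} (P : probability T R) (gam : 'I_m -> R)
  (Y : 'I_m -> T -> R) (w : 'I_n -> 'I_m -> R) (x : 'I_n -> R) :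
  (forall j, measurable_fun setT (Y j)) ->
  (forall j, has_gamma_law P (gam j) (Y j)) -> mutually_independent P Y ->
  (forall i j, 0 <= w i j) -> (forall i, 0 <= x i) ->
  (\int[P]_t (expR (- (\sum_i x i * \sum_j w i j * Y j t)))%:E =
   (\prod_j (1 + \sum_i w i j * x i) `^ (- gam j))%:E)%E.
Proof.
move=> mY lawY indY w0 x0.
(* The coefficient of [Y j] once the double sum is exchanged. The finite value of its Laplace
   transform also gives the integrability required by the product rule. *)
pose s j := \sum_i w i j * x i.
have s0 j : 0 <= s j by apply: sumr_ge0 => i _; rewrite mulr_ge0.
have Laplace j := gamma_Laplace P (gam j) (s j) (Y j) (mY j) (lawY j) (s0 j).
transitivity (\int[P]_t (\prod_j expR (- (s j * Y j t)))%:E)%E.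
  apply: eq_integral => t _; rewrite -expR_sum sumrN; congr (expR (- _))%:E.
  under eq_bigr do rewrite mulr_sumr.
  rewrite exchange_big; apply: eq_bigr => j _; rewrite /s mulr_suml.
  by apply: eq_bigr => i _; rewrite mulrCA mulrA.
rewrite (expectation_prod_indep _ _ Y (fun j y => expR (- (s j * y))))//.
- by rewrite -prodEFin; apply: eq_bigr => j _; rewrite Laplace.
- by move=> j /=; apply: measurableT_comp => //; exact: measurableT_comp.
- by move=> j; rewrite Laplace.
Qed.

(** Glued by sign from the power function with exponent -1; at 0 the inverse is 0 by convention. *)
Lemma measurable_invr {R : realType} :
  measurable_fun [set: R] (GRing.inv : R -> R).
Proof.
have -> : (GRing.inv : R -> R) =
    (fun x => if 0 < x then x `^ (-1) else if x < 0 then - (- x) `^ (-1) else 0).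
  apply/funext => x; have [x0|x0|<-] := ltgtP 0 x; last by rewrite invr0.
    by rewrite powR_inv1 ?ltW.
  by rewrite powR_inv1 ?oppr_ge0 ?ltW// invrN opprK.
apply: measurable_fun_if => //; first exact: measurable_fun_ltr.
  exact: measurable_funTS.
apply: measurable_funTS; apply: measurable_fun_if => //.
  exact: measurable_fun_ltr.
apply: measurable_funTS; apply: measurableT_comp => //.
exact: (measurableT_comp (measurable_powR _)).
Qed.

(** * Tails determine the law of a vector *)

Definition open_uppers (R : realType) (n : nat) : set (set ('I_n -> R)) :=
  [set B | exists a : 'I_n -> R, B = [set x | forall i, a i < x i]].

Lemma open_uppers_setI_closed (R : realType) (n : nat) :
  setI_closed (@open_uppers R n).
Proof.
move=> _ _ [a ->] [b ->]; exists (fun i => Num.max (a i) (b i)).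
apply/seteqP; split => x /=; first by move=> [xa xb] i; rewrite gt_max xa xb.
by move=> h; split => i; have := h i; rewrite gt_max => /andP[].
Qed.

Lemma open_uppers_cover (R : realType) (n : nat) :
  \bigcup_k [set x : 'I_n -> R | forall i, - k%:R < x i] = setT.
Proof.
apply/seteqP; split => // x _; exists (\max_i (Num.truncn `|x i|).+1) => // i /=.
rewrite ltrNl (le_lt_trans (ler_norm _))// normrN.
apply: (lt_le_trans (truncnS_gt _)); rewrite ler_nat.
exact: (leq_bigmax i).
Qed.

(** The harder inclusion needs the coordinates to be measurable for the upper boxes: a half-space
    [a < x i] is the union over [k] of the boxes whose other corners are [- k]. *)
Lemma rectangles_open_uppers (R : realType) (n : nat) :
  <<s @rectangles R n >> = <<s @open_uppers R n >>.
Proof.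
apply/seteqP; split; apply: smallest_sub; try exact: smallest_sigma_algebra.
  have mcoord i : measurable_fun setT
      ((fun x => x i) : g_sigma_algebraType (@open_uppers R n) -> R).
    apply: (measurability _ (RGenOInfty.measurableE R)) => _ [_ [a ->] <-].
    rewrite setTI.
    have -> : (fun x : g_sigma_algebraType (@open_uppers R n) => x i) @^-1`
        `]a, +oo[ =
        \bigcup_k [set x | forall j, (if j == i then a else - k%:R) < x j].
      apply/seteqP; split => x /=; rewrite in_itv/= andbT.
        move=> ax; have : (\bigcup_k [set x : 'I_n -> R | forall i, - k%:R < x i]) x.
          by rewrite open_uppers_cover.
        by move=> [k _ xk]; exists k => // j; case: eqVneq => [->|].
      by move=> [k _ /(_ i)]; rewrite eqxx.
    apply: bigcupT_measurable => k; apply: sub_gen_smallest.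
    by exists (fun j => if j == i then a else - k%:R).
  move=> _ [A [mA ->]].
  apply: (@fin_bigcap_measurable _ (g_sigma_algebraType (@open_uppers R n))) => // i _.
  by rewrite -[X in measurable X]setTI; exact: mcoord.
move=> _ [a ->]; apply: sub_gen_smallest.
exists (fun i => `]a i, +oo[%classic); split => //.
by rewrite (upper_tailE (fun i x => x i)).
Qed.

Lemma measurable_upper_tail {R : realType} {n : nat} {d : measure_display}
  {T : measurableType d} (X : 'I_n -> T -> R) (a : 'I_n -> R) :
  (forall i, measurable_fun setT (X i)) ->
  measurable [set t | forall i, a i < X i t].
Proof.
move=> mX; rewrite -upper_tailE; apply: fin_bigcap_measurable => // i _.
by rewrite -[X in measurable X]setTI; exact: mX.
Qed.

Lemma cvg_upper_tail {R : realType} {n : nat} {d : measure_display}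
  {T : measurableType d} (P : probability T R) (X : 'I_n -> T -> R)
  (a : 'I_n -> R) :
  (forall i, measurable_fun setT (X i)) ->
  P [set t | forall i, a i + k.+1%:R^-1 < X i t] @[k --> \oo] -->
  P [set t | forall i, a i < X i t].
Proof.
move=> mX.
have -> : [set t | forall i, a i < X i t] =
    \bigcup_k [set t | forall i, a i + k.+1%:R^-1 < X i t].
  apply/seteqP; split => t /=; last first.
    by move=> [k _ /= h] i; rewrite (lt_trans _ (h i))// ltrDl.
  (* This [k] makes [k.+1] exceed the inverse of every gap [X i t - a i]; the successor in the
     radius absorbs the truncation. *)
  move=> h; exists (\max_i (Num.truncn (X i t - a i)^-1)) => // i /=.
  rewrite -ltrBrDl -[ltRHS]invrK ltf_pV2 ?posrE ?invr_gt0 ?subr_gt0//.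
  apply: (lt_le_trans (truncnS_gt _)); rewrite ler_nat ltnS.
  exact: (leq_bigmax i).
have mS k : measurable [set t | forall i, a i + k.+1%:R^-1 < X i t].
  exact: measurable_upper_tail.
apply: nondecreasing_cvg_mu => //; first exact: bigcupT_measurable.
move=> k l kl; apply/subsetPset => t /= h i; apply: le_lt_trans (h i).
by rewrite lerD2l lef_pV2 ?posrE// ler_nat.
Qed.

(* Tails at positive points only generate the sigma-algebra of the open orthant;
   monotone limits transfer its full mass from [X2] to [X1]. *)
Lemma eq_in_distribution_positive {R : realType} {n : nat}
  {d1 d2 : measure_display} {T1 : measurableType d1} {T2 : measurableType d2}
  (P1 : probability T1 R) (P2 : probability T2 R)
  (X1 : 'I_n -> T1 -> R) (X2 : 'I_n -> T2 -> R) :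
  (forall i, measurable_fun setT (X1 i)) ->
  (forall i, measurable_fun setT (X2 i)) ->
  (forall i, {ae P2, forall t, 0 < X2 i t}) ->
  (forall x : 'I_n -> R, (forall i, 0 < x i) ->
    P1 [set t | forall i, x i < X1 i t] = P2 [set t | forall i, x i < X2 i t]) ->
  eq_in_distribution P1 P2 X1 X2.
Proof.
move=> mX1 mX2 X2_gt0 tailE.
have tailE0 (a : 'I_n -> R) : (forall i, 0 <= a i) ->
    P1 [set t | forall i, a i < X1 i t] = P2 [set t | forall i, a i < X2 i t].
  (* Shifting a nonnegative corner by [k.+1%:R^-1] makes it positive, so both probabilities are
     limits of one sequence. *)
  move=> a0; apply: (cvg_unique _ (cvg_upper_tail P1 X1 a mX1)) => //.
  have -> : (fun k => P1 [set t | forall i, a i + k.+1%:R^-1 < X1 i t]) =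
            (fun k => P2 [set t | forall i, a i + k.+1%:R^-1 < X2 i t]).
    by apply/funext => k; apply: tailE => i; rewrite ltr_wpDl.
  exact: cvg_upper_tail.
have {}X2_gt0 : {ae P2, forall t i, 0 < X2 i t} by exact: filter_forall.
have X1_gt0 : {ae P1, forall t i, 0 < X1 i t}.
  apply: ae_probability1; first exact: measurable_upper_tail.
  rewrite (tailE0 (fun=> 0))// -(@probability_setT _ _ _ P2).
  apply: probability_eq_ae => //; first exact: measurable_upper_tail.
  exact: filterS X2_gt0.
(* Boxes covering the whole space have negative corners; since both vectors are almost surely
   positive, such corners may be raised to 0. *)
have tailE' (a : 'I_n -> R) :
    P1 [set t | forall i, a i < X1 i t] = P2 [set t | forall i, a i < X2 i t].
  have max0 d (T : measurableType d) (P : probability T R) (X : 'I_n -> T -> R) :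
      (forall i, measurable_fun setT (X i)) ->
      {ae P, forall t i, 0 < X i t} ->
      P [set t | forall i, a i < X i t] =
      P [set t | forall i, Num.max (a i) 0 < X i t].
    move=> mX X0; apply: probability_eq_ae; try exact: measurable_upper_tail.
    apply: filterS X0 => t X0; split => /= h i; have := h i.
      by rewrite gt_max X0 andbT.
    by rewrite gt_max => /andP[].
  rewrite (max0 _ _ P1 X1)// (max0 _ _ P2 X2)//.
  by apply: tailE0 => i; rewrite le_max lexx orbT.
pose u1 : {mfun T1 >-> g_sigma_algebraType (@rectangles R n)} :=
  mfun_Sub (mem_set (measurable_vector X1 mX1)).
pose u2 : {mfun T2 >-> g_sigma_algebraType (@rectangles R n)} :=
  mfun_Sub (mem_set (measurable_vector X2 mX2)).
move=> B mB.
(* Uniqueness on a pi-system needs a covering sequence of finite mass: the boxes with all corners at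
   [- k]. *)
apply: (@measure_unique _ R (g_sigma_algebraType (@rectangles R n))
  (@open_uppers R n) (fun k => [set x | forall i, - k%:R < x i])
  _ _ _ _ (distribution P1 u1) (distribution P2 u2)) => //.
- exact: rectangles_open_uppers.
- exact: open_uppers_setI_closed.
- by move=> k; exists (fun=> - k%:R).
- exact: open_uppers_cover.
- by move=> _ [a ->]; exact: tailE'.
- move=> k; rewrite -ge0_fin_numE// fin_num_measure//.
  rewrite /measurable/= rectangles_open_uppers; apply: sub_gen_smallest.
  by exists (fun=> - k%:R).
Qed.

(** * Comparison of [X] with the vector of ratios *)

Theorem theorem2p2 (R : realType) (n : nat)
  (c : 'I_n -> 'I_n.+1 -> bool) (sigma : 'I_n -> R) (gam : 'I_n.+1 -> R)
  (hsigma : forall i, 0 < sigma i) (hgam : forall j, 0 < gam j)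
  (hc : forall i, 0 < \sum_(j < n.+1) (c i j)%:R * gam j)
  (d : measure_display) (T : measurableType d) (P : probability T R)
  (Lam : 'I_n -> T -> R) (Y : 'I_n.+1 -> T -> R)
  (hLam_meas : forall i, measurable_fun [set: T] (Lam i))
  (hY_meas : forall j, measurable_fun [set: T] (Y j))
  (hLam_law : forall i, has_exp_law P 1 (Lam i))
  (hLam_indep : mutually_independent P Lam)
  (hY_law : forall j, has_gamma_law P (gam j) (Y j))
  (hY_indep : mutually_independent P Y)
  (hindep : independent_vectors P Lam
     (fun i t => \sum_(j < n.+1) (c i j)%:R / sigma i * Y j t))
  (d' : measure_display) (T' : measurableType d') (P' : probability T' R)
  (X : 'I_n -> T' -> R) (hX_meas : forall i, measurable_fun [set: T'] (X i)) :
  (forall x : 'I_n -> R, (forall i, 0 < x i) ->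
     P' (\bigcap_(i in [set: 'I_n]) (X i @^-1` `]x i, +oo[)) =
     (\prod_(j < n.+1)
        (1 + \sum_(i < n) (c i j)%:R / sigma i * x i) `^ (- gam j))%:E)
  <->
  eq_in_distribution P' P X
    (fun i t => Lam i t / (\sum_(j < n.+1) (c i j)%:R / sigma i * Y j t)).
Proof.
pose Xi i t := \sum_(j < n.+1) (c i j)%:R / sigma i * Y j t.
have mXi i : measurable_fun setT (Xi i).
  by apply: measurable_sum => j; exact: measurable_funM.
have mratio i : measurable_fun setT (fun t => Lam i t / Xi i t).
  apply: measurable_funM => //; exact: measurableT_comp measurable_invr _.
have w0 i j : 0 <= (c i j)%:R / sigma i by rewrite divr_ge0// ltW.
have Y_gt0 : {ae P, forall t j, 0 < Y j t}.
  by apply: filter_forall => j; exact: gamma_law_gt0 (hY_law j).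
have Xi_gt0 i : {ae P, forall t, 0 < Xi i t}.
  apply: filterS Y_gt0 => t Yt.
  (* If row [i] of [c] vanished, so would the sum in [hc i]. A single entry 1 makes [Xi i] at least
     [Y j / sigma i] almost surely. *)
  have [j cij] : exists j, c i j.
    apply/not_existsP => cF; have := hc i.
    by rewrite big1 ?ltxx// => j _; case: (c i j) (cF j) => //; rewrite mul0r.
  rewrite /Xi (bigD1 j)//= ltr_pwDl//.
    by rewrite cij mul1r mulr_gt0 ?invr_gt0.
  by apply: sumr_ge0 => k _; rewrite mulr_ge0// ltW.
(* The product formula is the tail of the vector of ratios, so in both directions it remains to
   compare [X] with that vector. *)
have tailE x : (forall i, 0 < x i) ->
    P (\bigcap_(i in [set: 'I_n])
         ((fun t => Lam i t / Xi i t) @^-1` `]x i, +oo[)) =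
    (\prod_(j < n.+1)
      (1 + \sum_(i < n) (c i j)%:R / sigma i * x i) `^ (- gam j))%:E.
  move=> x0; rewrite exp_ratio_tail//.
  by apply: gamma_sum_Laplace => // i; exact: ltW.
split => [XE|XE x x0].
  apply: eq_in_distribution_positive => //.
    move=> i.
    apply: filterS2 (exp_law_gt0 _ _ (hLam_meas i) (hLam_law i)) (Xi_gt0 i) => t.
    exact: divr_gt0.
  by move=> x x0; rewrite -!upper_tailE XE// tailE.
rewrite -tailE//.
(* A tail is the probability of a product of half-lines, which is a generator of the
   sigma-algebra. *)
have := XE (\bigcap_(i in [set: 'I_n]) ((fun y => y i) @^-1` `]x i, +oo[)).
rewrite !preimage_bigcap; apply; apply: sub_gen_smallest.
by exists (fun i => `]x i, +oo[%classic).
Qed.
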